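(* Let $\kappa,\nu>0$, let $\Phi\in C^\infty(\mathbb T^2)$ be even with $\int_{\mathbb T^2}\Phi\,d\mathbf x=1$, and let $\Psi\in C^\infty(\mathbb T)$ satisfy $\Psi(\theta)=\sin(\theta)\psi(\theta)$ with $0\le\psi\in C^\infty(\mathbb T)$ even and $\int_{-\pi}^\pi\Psi\,d\theta=0$. Consider the spatially homogeneous equation $$\partial_t g-\kappa\Big(\int_{\mathbb T^2}\Phi\,d\mathbf x\Big)\partial_\theta\big(g\,(\Psi*g)\big)=\nu\,\partial_\theta^2 g,\qquad \theta\in\mathbb T. \tag{E}$$ Let $\mathbb U(\theta)=\int_{-\pi}^\theta\Psi(\eta)\,d\eta\in C^\infty(\mathbb T)$. a) If $g\in C^3_{t,\theta}$ is a regular positive solution of (E), then the free energy $$F[g]:=\nu\int_{\mathbb T}g\log g\,d\theta+\frac\kappa2\iint_{\mathbb T\times\mathbb T}\mathbb U(\theta-w)g(\theta)g(w)\,dw\,d\theta$$ is decaying in time; precisely, $$\frac{d}{dt}F[g]=-\int_{\mathbb T} g\,\big|\nu\,\partial_\theta\log g+\kappa\,\Psi*g\big|^2\,d\theta=:-\mathcal D[g]\le 0.$$ b) If $$\sup_{\ell\in\mathbb Z\setminus\{0\}}\frac{\kappa}{2\pi}\big|\widehat{\mathbb U}(\ell)\big|<\nu,$$ then the constant state $g\equiv\frac1{2\pi}$ is linearly stable. If there exists $\ell\in\mathbb Z\setminus\{0\}$ such that $$-\frac{\kappa}{2\pi}\,\mathrm{Re}\,\widehat{\mathbb U}(\ell)>\nu,$$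 then the constant state $g\equiv\frac1{2\pi}$ is linearly unstable.
   Context: $\mathbb T=\mathbb R/2\pi\mathbb Z$, identified with $[-\pi,\pi]$; $*$ is convolution in $\theta$, $(\Psi*g)(\theta)=\int_{\mathbb T}\Psi(\theta-w)g(w)\,dw$. Fourier coefficients: $\widehat{\mathbb U}(\ell)=\int_{-\pi}^{\pi}\mathbb U(\theta)e^{-i\ell\theta}\,d\theta$. Linear stability refers to the linearization of (E) about $\frac1{2\pi}$, $$\partial_t\tilde g-\frac{\kappa}{2\pi}\partial_\theta(\partial_\theta\mathbb U*\tilde g)=\nu\,\partial_\theta^2\tilde g .$$ The constant state is linearly stable if every nonzero Fourier mode $\ell\ne0$ of every solution $\tilde g$ decays exponentially in time; it is linearly unstable if some Fourier mode $\ell\neq 0$ is a growing mode (solutions with a nonzero $\ell$-th coefficient have that coefficient growing exponentially in time). *)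

(* Defs.v *)
From Stdlib Require Import Reals ZArith.
From Coquelicot Require Import Coquelicot.

Open Scope R_scope.

(* Functions on the torus are 2 PI-periodic functions on R (in each variable);
   integrals over the torus are taken over [-PI, PI]. *)

Definition periodic (f : R -> R) : Prop := forall x, f (x + 2 * PI) = f x.

Definition even (f : R -> R) : Prop := forall x, f (- x) = f x.

Definition smooth_T (f : R -> R) : Prop :=
  periodic f /\ forall n x, ex_derive_n f n x.

(* [ex_diff_n f n x y] at every point of an open set is C^n regularity there:
   all iterated partial derivatives of order <= n exist and are continuous. *)
Definition smooth_T2 (f : R -> R -> R) : Prop :=
  (forall y, periodic (fun x => f x y)) /\
  (forall x, periodic (f x)) /\
  forall n x y, ex_diff_n f n x y.

Definition even2 (f : R -> R -> R) : Prop :=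
  forall x y, f (- x) (- y) = f x y.

Definition int_T (f : R -> R) : R := RInt f (- PI) PI.

Definition int_T2 (f : R -> R -> R) : R := int_T (fun x => int_T (f x)).

Definition conv (f h : R -> R) (theta : R) : R :=
  int_T (fun w => f (theta - w) * h w).

Definition cis (x : R) : C := (cos x, sin x).

Definition int_T_C (f : R -> C) : C :=
  (int_T (fun x => Re (f x)), int_T (fun x => Im (f x))).

Definition fourier (f : R -> R) (l : Z) : C :=
  int_T_C (fun theta => (RtoC (f theta) * cis (- (IZR l * theta)))%C).

Definition potential (Psi : R -> R) (theta : R) : R := RInt Psi (- PI) theta.

(* Time-dependent functions are written [g t theta], on an open time
   interval ]a, b[ with possibly infinite end points. *)
Definition in_time (a b : Rbar) (t : R) : Prop := Rbar_lt a t /\ Rbar_lt t b.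

Definition solves_E (kappa nu : R) (Phi : R -> R -> R) (Psi : R -> R)
    (a b : Rbar) (g : R -> R -> R) : Prop :=
  forall t theta, in_time a b t ->
    Derive (fun s => g s theta) t
    - kappa * int_T2 Phi * Derive (fun x => g t x * conv Psi (g t) x) theta
    = nu * Derive_n (g t) 2 theta.

Definition regular_positive_solution_E (kappa nu : R) (Phi : R -> R -> R)
    (Psi : R -> R) (a b : Rbar) (g : R -> R -> R) : Prop :=
  (forall t, in_time a b t -> periodic (g t)) /\
  (forall t theta, in_time a b t -> ex_diff_n g 3 t theta) /\
  (forall t theta, in_time a b t -> 0 < g t theta) /\
  solves_E kappa nu Phi Psi a b g.

Definition free_energy (kappa nu : R) (U g : R -> R) : R :=
  nu * int_T (fun theta => g theta * ln (g theta))
  + kappa / 2 *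
    int_T (fun theta => int_T (fun w => U (theta - w) * g theta * g w)).

Definition dissipation (kappa nu : R) (Psi g : R -> R) : R :=
  int_T (fun theta =>
    g theta *
    Rabs (nu * Derive (fun x => ln (g x)) theta + kappa * conv Psi g theta) ^ 2).

(* Classical (C^1 in time, C^2 in angle) solutions, for all positive times, of
   the linearization about 1 / (2 PI).  No regularity as t -> 0 is required. *)
Definition linearized_solution (kappa nu : R) (U : R -> R)
    (h : R -> R -> R) : Prop :=
  (forall t, 0 < t -> periodic (h t)) /\
  (forall t theta, 0 < t ->
     continuity_2d_pt h t theta /\
     ex_derive (fun s => h s theta) t /\
     ex_derive (h t) theta /\
     ex_derive_n (h t) 2 theta /\
     continuity_2d_pt (fun s x => Derive (fun r => h r x) s) t theta /\
     continuity_2d_pt (fun s x => Derive_n (h s) 2 x) t theta) /\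
  (forall t theta, 0 < t ->
     Derive (fun s => h s theta) t
     - kappa / (2 * PI) * Derive (conv (Derive U) (h t)) theta
     = nu * Derive_n (h t) 2 theta).

Definition decays_exponentially (z : R -> C) : Prop :=
  exists c lambda : R, 0 < lambda /\
    forall t, 0 < t -> Cmod (z t) <= c * exp (- lambda * t).

Definition grows_exponentially (z : R -> C) : Prop :=
  exists c lambda : R, 0 < c /\ 0 < lambda /\
    forall t, 0 < t -> c * exp (lambda * t) <= Cmod (z t).

Definition linearly_stable (kappa nu : R) (U : R -> R) : Prop :=
  forall h, linearized_solution kappa nu U h ->
  forall l : Z, l <> 0%Z -> decays_exponentially (fun t => fourier (h t) l).

Definition has_mode (h : R -> R -> R) (l : Z) : Prop :=
  exists t, 0 < t /\ fourier (h t) l <> RtoC 0.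

(* The first conjunct prevents a mode from being growing vacuously. *)
Definition growing_mode (kappa nu : R) (U : R -> R) (l : Z) : Prop :=
  (exists h, linearized_solution kappa nu U h /\ has_mode h l) /\
  forall h, linearized_solution kappa nu U h -> has_mode h l ->
    grows_exponentially (fun t => fourier (h t) l).

Definition linearly_unstable (kappa nu : R) (U : R -> R) : Prop :=
  exists l : Z, l <> 0%Z /\ growing_mode kappa nu U l.

(* Main.v *)
Require Import Defs.
From Stdlib Require Import Reals ZArith Lra Classical ClassicalEpsilon.
From Coquelicot Require Import Coquelicot.
Open Scope R_scope.

(* (a) Equation (E) says that the time derivative of g is J', where
   J = g L' and L = nu (log g + 1) + kappa (U * g).  As U is even, convolution
   with U is self-adjoint, so dF/dt is the integral of J' L, and an integration
   by parts turns it into minus the integral of g (L')^2.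

   (b) Since U is even, cos (l x + phi) is an eigenfunction of convolution with
   U, with eigenvalue the l-th Fourier coefficient of U, which is real.  Testing
   the linearized equation against it shows that the l-th mode solves
   z' = - l^2 (kappa / (2 PI) Re Uhat(l) + nu) z, and the sign of the rate
   decides between exponential decay and exponential growth. *)

(** * Continuity *)

(** The structure of [Psi] is used through [U]: [Psi] is odd because [psi] is even, which makes [U]
    even, and its zero mean makes [U] periodic, so that no boundary term survives an integration by
    parts. Solutions have limited regularity, so angular derivatives of a convolution are put on the
    kernel, and the other factor only has to be continuous. Exchanging limits, derivatives and
    integrals rests on joint continuity over a compact interval. Linearized solutions have no
    prescribed value at time 0, hence modes are normalized at time 1. Growth is required of every
    solution that carries the mode, and such a solution must exist: the proof therefore needs an
    exact formula for the coefficient as well as an explicit solution. *)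

Section Continuity.
Context {T : UniformSpace}.
Implicit Types (f h : T -> R) (x : T).

Lemma cont_plus f h x :
  continuous f x -> continuous h x -> continuous (fun y => f y + h y) x.
Proof. exact (continuous_plus (V := R_NormedModule) f h x). Qed.

Lemma cont_mult f h x :
  continuous f x -> continuous h x -> continuous (fun y => f y * h y) x.
Proof. exact (continuous_mult (K := R_AbsRing) f h x). Qed.

Lemma cont_minus f h x :
  continuous f x -> continuous h x -> continuous (fun y => f y - h y) x.
Proof. exact (continuous_minus (V := R_NormedModule) f h x). Qed.

Lemma cont_opp f x : continuous f x -> continuous (fun y => - f y) x.
Proof. exact (continuous_opp (V := R_NormedModule) f x). Qed.

Lemma cont_comp (u : R -> R) f x :
  (forall y, continuous u y) -> continuous f x -> continuous (fun y => u (f y)) x.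
Proof. intros Hu Hf; apply (continuous_comp f u); auto. Qed.

Lemma cont_inv f x : f x <> 0 -> continuous f x -> continuous (fun y => / f y) x.
Proof.
  intros H Hf; apply (continuous_comp f Rinv); [exact Hf |].
  apply continuity_pt_filterlim, continuity_pt_inv; [| exact H].
  apply derivable_continuous_pt, derivable_pt_id.
Qed.

Lemma cont_ln f x : 0 < f x -> continuous f x -> continuous (fun y => ln (f y)) x.
Proof.
  intros H Hf; apply (continuous_comp f ln); [exact Hf |].
  apply continuity_pt_filterlim, derivable_continuous_pt.
  exists (/ f x); apply derivable_pt_lim_ln, H.
Qed.

End Continuity.

(** Stated on the product space, where the composition and parameter-integral lemmas for uniform
    spaces apply. *)
Definition continuous2 (h : R -> R -> R) (s w : R) : Prop :=
  continuous (fun z : R * R => h (fst z) (snd z)) (s, w).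

Lemma continuous2_2d_pt h s w : continuous2 h s w <-> continuity_2d_pt h s w.
Proof. symmetry; apply continuity_2d_pt_filterlim. Qed.

Lemma continuous2_comp {T : UniformSpace} h (u v : T -> R) (x : T) :
  continuous u x -> continuous v x -> continuous2 h (u x) (v x) ->
  continuous (fun y => h (u y) (v y)) x.
Proof. intros; apply (continuous_comp_2 u v h x); assumption. Qed.

Lemma continuous2_slice_r h s w : continuous2 h s w -> continuous (h s) w.
Proof.
  intros H.
  apply (continuous2_comp h (fun _ => s) (fun y => y) w);
    [apply continuous_const | apply continuous_id | exact H].
Qed.

Lemma continuous2_slice_l h s w :
  continuous2 h s w -> continuous (fun r => h r w) s.
Proof.
  intros H.
  apply (continuous2_comp h (fun r => r) (fun _ => w) s);
    [apply continuous_id | apply continuous_const | exact H].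
Qed.

Lemma cont_fst {S T : UniformSpace} (z : S * T) : continuous fst z.
Proof. destruct z; apply continuous_fst. Qed.

Lemma cont_snd {S T : UniformSpace} (z : S * T) : continuous snd z.
Proof. destruct z; apply continuous_snd. Qed.

Lemma is_derive_cont (f : R -> R) x l : is_derive f x l -> continuous f x.
Proof. intros H; apply @ex_derive_continuous; exists l; exact H. Qed.

Lemma cont_cos x : continuous cos x.
Proof. apply continuity_pt_filterlim, continuity_cos. Qed.

Lemma cont_sin x : continuous sin x.
Proof. apply continuity_pt_filterlim, continuity_sin. Qed.

(* Purely syntactic: unifying [cos], [sin] or [Rmult] with an arbitrary function
   unfolds their definitions and may not return. *)
Ltac cont :=
  repeat match goal with
    | |- forall _, _ => intro
    | H : forall x, continuous ?f x |- continuous ?f _ => apply H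
    | |- continuous (fun _ => ?c) _ => apply continuous_const
    | |- continuous (fun y => y) _ => apply continuous_id
    | |- continuous (fun y => @?f y + @?h y) _ => apply (cont_plus f h)
    | |- continuous (fun y => @?f y - @?h y) _ => apply (cont_minus f h)
    | |- continuous (fun y => @?f y * @?h y) _ => apply (cont_mult f h)
    | |- continuous (fun y => - @?f y) _ => apply (cont_opp f)
    | |- continuous cos _ => apply cont_cos
    | |- continuous sin _ => apply cont_sin
    | |- continuous fst _ => apply cont_fst
    | |- continuous snd _ => apply cont_snd
    | |- continuous (fun y => fst y) _ => apply cont_fst
    | |- continuous (fun y => snd y) _ => apply cont_snd
    | |- continuous (fun y => ?f (@?u y)) _ => apply (cont_comp f u)
    end.

(** * Integrals depending on parameters *)

Lemma ex_RInt_cont (f : R -> R) a b : (forall x, continuous f x) -> ex_RInt f a b.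
Proof. intros H; apply (ex_RInt_continuous (V := R_CompleteNormedModule)); auto. Qed.

(** A tube lemma: continuity at each point of the slice over [p] gives a radius depending on [w],
    chosen as a function [delta], and compactness of the interval bounds these radii below. *)
Lemma locally_uniform_limit {T : UniformSpace} (f : T -> R -> R) (p : T) a b :
  (forall w, continuous (fun z : T * R => f (fst z) (snd z)) (p, w)) ->
  forall eps : posreal,
  locally p (fun q => forall w, a <= w <= b -> Rabs (f q w - f p w) < eps).
Proof.
  intros Hf eps.
  assert (Hd : forall w, exists d : posreal, forall q v,
             ball p d q -> Rabs (v - w) < d -> Rabs (f q v - f p w) < eps / 2).
  { intros w.
    assert (He : 0 < eps / 2) by (destruct eps; simpl; lra).
    destruct (proj1 (filterlim_locally _ _) (Hf w) (mkposreal _ He)) as [d Hd].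
    exists d; intros q v Hq Hv.
    apply (Hd (q, v)); split; assumption. }
  set (delta := fun w => proj1_sig (constructive_indefinite_description _ (Hd w))).
  assert (Hdelta : forall w q v, ball p (delta w) q -> Rabs (v - w) < delta w ->
             Rabs (f q v - f p w) < eps / 2).
  { intros w; exact (proj2_sig (constructive_indefinite_description _ (Hd w))). }
  destruct (compactness_value_1d a b delta) as [d Hc].
  exists d; intros q Hq w Hw.
  (* Compactness supplies the centre [t] only under a double negation, which is discharged against
     the negated goal. *)
  apply NNPP; intros Hn; apply (Hc w Hw); intros [t [_ [Hwt Hdt]]]; apply Hn.
  pose proof (Hdelta t q w (ball_le p _ _ Hdt q Hq) Hwt) as H1.
  pose proof (Hdelta t p w (ball_center p (delta t)) Hwt) as H2.
  replace (f q w - f p w) with ((f q w - f p t) - (f p w - f p t)) by ring.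
  eapply Rle_lt_trans; [apply Rabs_triang|]; rewrite Rabs_Ropp; lra.
Qed.

Lemma continuous_RInt_param {T : UniformSpace} (f : T -> R -> R) (p : T) a b :
  a <= b ->
  (forall w, continuous (fun z : T * R => f (fst z) (snd z)) (p, w)) ->
  locally p (fun q => ex_RInt (f q) a b) ->
  continuous (fun q => RInt (f q) a b) p.
Proof.
  intros Hab Hf Hi.
  apply filterlim_locally; intros eps.
  (* The added 1 covers the degenerate interval a = b and makes the final bound strict. *)
  assert (He : 0 < eps / (b - a + 1)).
  { apply Rdiv_lt_0_compat; [apply cond_pos | lra]. }
  pose proof (locally_uniform_limit f p a b Hf (mkposreal _ He)) as Hu.
  pose proof (locally_singleton _ _ Hi) as Hp.
  generalize (filter_and _ _ Hu Hi); apply filter_imp; intros q [Hq Hqi].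
  change (Rabs (RInt (f q) a b - RInt (f p) a b) < eps).
  rewrite <- (RInt_minus (V := R_CompleteNormedModule)) by assumption.
  apply Rle_lt_trans with ((b - a) * (eps / (b - a + 1))).
  - apply abs_RInt_le_const; [exact Hab | |].
    + apply (ex_RInt_minus (V := R_NormedModule)); assumption.
    + intros t Ht; left; exact (Hq t Ht).
  - apply Rlt_le_trans with ((b - a + 1) * (eps / (b - a + 1))).
    + apply Rmult_lt_compat_r; [exact He | lra].
    + right; field; lra.
Qed.

(** The candidate [df] for the partial derivative is chosen by the caller, so that its joint
    continuity can be checked on a convenient formula. *)
Lemma is_derive_RInt_param_cont (f df : R -> R -> R) a b x :
  locally x (fun y => forall t, is_derive (fun u => f u t) y (df y t)) ->
  locally x (fun y => forall t, continuous (f y) t) ->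
  (forall t, continuous2 df x t) ->
  is_derive (fun y => RInt (f y) a b) x (RInt (df x) a b).
Proof.
  intros Hd Hc Hdf.
  rewrite <- (RInt_ext (fun t => Derive (fun u => f u t) x)).
  - apply (is_derive_RInt_param f).
    + generalize Hd; apply filter_imp; intros y Hy t _; eexists; apply Hy.
    + intros t _; apply (continuity_2d_pt_ext_loc df).
      * destruct Hd as [d Hd]; exists d; intros u v Hu _.
        symmetry; apply is_derive_unique, Hd, Hu.
      * apply continuous2_2d_pt, Hdf.
    + generalize Hc; apply filter_imp; intros y Hy; apply ex_RInt_cont, Hy.
  - intros t _; apply is_derive_unique, (locally_singleton _ _ Hd).
Qed.

(** Workhorse for identities between integrals: let a bound vary, check that the difference of the
    two sides has zero derivative, and compare with a point where it is known. *)
Lemma is_derive_zero_eq (f : R -> R) :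
  (forall x, is_derive f x 0) -> forall x y, f x = f y.
Proof.
  intros H x y; destruct (Rtotal_order x y) as [Hxy | [-> | Hxy]].
  - apply (eq_is_derive (V := R_NormedModule) f); auto.
  - reflexivity.
  - symmetry; apply (eq_is_derive (V := R_NormedModule) f); auto.
Qed.

Lemma is_derive_RInt_cont (f : R -> R) a x :
  (forall y, continuous f y) -> is_derive (fun y => RInt f a y) x (f x).
Proof.
  intros Hf; apply (is_derive_RInt (V := R_NormedModule) f _ a); [| apply Hf].
  apply filter_forall; intros y.
  apply (RInt_correct (V := R_CompleteNormedModule)), ex_RInt_cont, Hf.
Qed.

(* Both sides, as functions of [b], have derivative [RInt (f b) c d]. *)
Lemma RInt_swap (f : R -> R -> R) a b c d :
  c <= d -> (forall x y, continuous2 f x y) ->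
  RInt (fun x => RInt (f x) c d) a b = RInt (fun y => RInt (fun x => f x y) a b) c d.
Proof.
  intros Hcd Hf.
  pose (G := fun u => RInt (fun x => RInt (f x) c d) a u
                      - RInt (fun y => RInt (fun x => f x y) a u) c d).
  assert (Hl : forall y x, continuous (fun x => f x y) x).
  { intros y x; apply continuous2_slice_l, Hf. }
  assert (Hr : forall x y, continuous (f x) y).
  { intros x y; apply continuous2_slice_r, Hf. }
  assert (HG : forall u, is_derive G u 0).
  { intros u.
    replace 0 with (minus (RInt (f u) c d) (RInt (f u) c d))
      by apply (minus_eq_zero (G := R_AbelianGroup)).
    apply (is_derive_minus (V := R_NormedModule)).
    - apply (is_derive_RInt_cont (fun x => RInt (f x) c d)); intros x.
      apply (continuous_RInt_param f); [exact Hcd | intros w; apply Hf |].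
      apply filter_forall; intros q; apply ex_RInt_cont, Hr.
    - apply (is_derive_RInt_param_cont (fun v y => RInt (fun x => f x y) a v) f).
      + apply filter_forall; intros v y.
        apply (is_derive_RInt_cont (fun x => f x y)), Hl.
      + apply filter_forall; intros v y.
        (* [continuous_RInt_param] wants ordered bounds; the other case follows by reversing the
           integral. *)
        destruct (Rle_lt_dec a v) as [Hav | Hva].
        * apply (continuous_RInt_param (fun y x => f x y)); [exact Hav | |].
          -- intros w; apply (continuous2_comp f snd fst); cont; apply Hf.
          -- apply filter_forall; intros q; apply ex_RInt_cont, Hl.
        * apply (continuous_ext (fun y => - RInt (fun x => f x y) v a)).
          { intros z; apply (opp_RInt_swap (V := R_CompleteNormedModule)).
            apply ex_RInt_cont, Hl. }
          apply cont_opp.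
          apply (continuous_RInt_param (fun y x => f x y)); [lra | |].
          -- intros w; apply (continuous2_comp f snd fst); cont; apply Hf.
          -- apply filter_forall; intros q; apply ex_RInt_cont, Hl.
      + intros y; apply Hf. }
  pose proof (is_derive_zero_eq G HG b a) as Hba; unfold G in Hba.
  rewrite RInt_point in Hba.
  rewrite (RInt_ext (fun y => RInt (fun x => f x y) a a) (fun _ => 0)) in Hba
    by (intros y _; apply (RInt_point (V := R_CompleteNormedModule))).
  rewrite (RInt_const (V := R_CompleteNormedModule)) in Hba.
  unfold scal, zero in Hba; simpl in Hba; unfold mult in Hba; simpl in Hba; lra.
Qed.


(** * Integrals and convolutions over the torus *)

Lemma int_T_ext f h : (forall x, f x = h x) -> int_T f = int_T h.
Proof. intros H; apply RInt_ext; auto. Qed.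

Lemma int_T_plus (f h : R -> R) : (forall x, continuous f x) -> (forall x, continuous h x) ->
  int_T (fun x => f x + h x) = int_T f + int_T h.
Proof.
  intros Hf Hh.
  apply (RInt_plus (V := R_CompleteNormedModule)); apply ex_RInt_cont; assumption.
Qed.

Lemma int_T_scal c (f : R -> R) : (forall x, continuous f x) ->
  int_T (fun x => c * f x) = c * int_T f.
Proof.
  intros Hf; apply (RInt_scal (V := R_CompleteNormedModule)), ex_RInt_cont, Hf.
Qed.

(** Source of every integration by parts on the torus: it is applied to products, whose boundary
    values cancel. *)
Lemma int_T_derive_periodic (f df : R -> R) :
  periodic f -> (forall x, is_derive f x (df x)) -> (forall x, continuous df x) ->
  int_T df = 0.
Proof.
  intros Hp Hd Hc; unfold int_T.
  rewrite (is_RInt_unique _ _ _ _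
    (is_RInt_derive (V := R_CompleteNormedModule) f df (- PI) PI
       (fun x _ => Hd x) (fun x _ => Hc x))).
  replace PI with (- PI + 2 * PI) at 1 by ring; rewrite Hp.
  apply (minus_eq_zero (G := R_AbelianGroup)).
Qed.

(** [Derive] is a total limit of difference quotients, and these are periodic themselves; no
    differentiability is involved. *)
Lemma Derive_periodic f : periodic f -> periodic (Derive f).
Proof.
  intros Hp x; rewrite <- (Derive_ext (fun y => f (y + 2 * PI)) f x Hp).
  unfold Derive; f_equal; apply Lim_ext; intros h.
  now replace (x + h + 2 * PI) with (x + 2 * PI + h) by ring.
Qed.

(** The sliding window integral has derivative f (x + PI) - f (x - PI), which periodicity cancels.
    [G] anchors both pieces at 0 so that only upper bounds move. *)
Lemma RInt_shift_periodic (f : R -> R) x : (forall y, continuous f y) -> periodic f ->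
  RInt f (x - PI) (x + PI) = int_T f.
Proof.
  intros Hc Hp.
  pose (G := fun y => RInt f 0 (y + PI) - RInt f 0 (y - PI)).
  assert (HG : forall y, RInt f (y - PI) (y + PI) = G y).
  { intros y; unfold G.
    rewrite <- (RInt_Chasles f 0 (y - PI) (y + PI)) by (apply ex_RInt_cont, Hc).
    unfold plus; simpl; lra. }
  unfold int_T; transitivity (RInt f (0 - PI) (0 + PI)); [| f_equal; ring].
  rewrite !HG; apply is_derive_zero_eq; intros y.
  replace 0 with (1 * f (y + PI) - 1 * f (y - PI)).
  2:{ rewrite <- (Hp (y - PI)).
      replace (y - PI + 2 * PI) with (y + PI) by ring; ring. }
  apply (is_derive_minus (V := R_NormedModule));
    apply (is_derive_comp (V := R_NormedModule) (fun z => RInt f 0 z));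
    try (apply is_derive_RInt_cont, Hc); auto_derive; auto.
Qed.

Lemma int_T_odd (f : R -> R) : (forall x, continuous f x) -> (forall x, f (- x) = - f x) ->
  int_T f = 0.
Proof.
  intros Hc Ho; unfold int_T.
  pose (G := fun x => RInt f 0 x - RInt f 0 (- x)).
  assert (H : G PI = G 0).
  { apply is_derive_zero_eq; intros y.
    replace 0 with (f y - (-1) * f (- y)) by (rewrite Ho; ring).
    apply (is_derive_minus (V := R_NormedModule));
      [apply is_derive_RInt_cont, Hc |].
    apply (is_derive_comp (V := R_NormedModule) (fun z => RInt f 0 z));
      [apply is_derive_RInt_cont, Hc | auto_derive; auto]. }
  unfold G in H; rewrite Ropp_0 in H.
  rewrite <- (RInt_Chasles f (- PI) 0 PI) by (apply ex_RInt_cont, Hc).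
  rewrite <- (opp_RInt_swap f 0 (- PI)) by (apply ex_RInt_cont, Hc).
  unfold plus, opp; simpl; lra.
Qed.

Section Convolution.
Variable U : R -> R.
Hypothesis U_cont : forall x, continuous U x.

(** The substitution w = x - v sends the torus interval to a reversed window centred at [x];
    periodicity of the integrand recentres it. *)
Lemma conv_comm q x : periodic U -> (forall y, continuous q y) -> periodic q ->
  conv U q x = int_T (fun v => U v * q (x - v)).
Proof.
  intros HUp Hq Hqp; unfold conv.
  set (f := fun w => U (x - w) * q w).
  assert (Hf : forall w, continuous f w) by (intros w; unfold f; cont).
  assert (Hfp : periodic f).
  { intros w; unfold f; rewrite Hqp; f_equal.
    rewrite <- (HUp (x - (w + 2 * PI))); f_equal; ring. }
  rewrite <- (RInt_shift_periodic f x Hf Hfp).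
  rewrite <- (opp_RInt_swap f (x + PI)) by (apply ex_RInt_cont, Hf).
  replace (x + PI) with (-1 * - PI + x) by ring.
  replace (x - PI) with (-1 * PI + x) by ring.
  rewrite <- (RInt_comp_lin f (-1) x (- PI) PI) by (apply ex_RInt_cont, Hf).
  rewrite <- (RInt_opp (V := R_CompleteNormedModule)).
  - apply int_T_ext; intros v.
    unfold scal, opp, f; simpl; unfold mult; simpl.
    replace (x - (-1 * v + x)) with v by ring.
    replace (-1 * v + x) with (x - v) by ring; ring.
  - apply ex_RInt_cont; intros v; unfold scal; simpl; unfold mult; simpl.
    apply cont_mult; [apply continuous_const |].
    apply (cont_comp f); [exact Hf | cont].
Qed.

(** The parameter is the pair of time and angle: differentiating the interaction energy under the
    integral needs joint continuity in both. *)
Lemma continuous_conv_param (h : R -> R -> R) s x :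
  locally s (fun r => forall w, continuous2 h r w) ->
  continuous2 (fun r => conv U (h r)) s x.
Proof.
  intros Hh.
  apply (continuous_RInt_param
           (fun (p : R * R) w => U (snd p - w) * h (fst p) w) (s, x)).
  - pose proof PI_RGT_0; lra.
  - intros w; apply cont_mult.
    + apply (cont_comp U); [exact U_cont |].
      apply cont_minus; [| cont].
      apply (continuous_comp (fun z : R * R * R => fst z) (fun p : R * R => snd p)); cont.
    + apply (continuous2_comp h (fun z : R * R * R => fst (fst z)) (fun z => snd z)).
      * apply (continuous_comp (fun z : R * R * R => fst z) (fun p : R * R => fst p)); cont.
      * cont.
      * apply (locally_singleton _ _ Hh).
  - destruct Hh as [d Hd]; exists d; intros p [Hp _]; apply ex_RInt_cont.
    intros w; apply cont_mult; [cont | apply continuous2_slice_r, Hd, Hp].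
Qed.

Lemma continuous_conv q x : (forall y, continuous q y) -> continuous (conv U q) x.
Proof.
  intros Hq; apply (continuous2_slice_r (fun _ => conv U q) 0).
  apply (continuous_conv_param (fun _ => q)).
  apply filter_forall; intros r w.
  apply (continuous_comp (fun z : R * R => snd z) q); cont.
Qed.

Lemma conv_periodic q : periodic U -> periodic (conv U q).
Proof.
  intros HU x; apply int_T_ext; intros w; f_equal.
  rewrite <- (HU (x - w)); f_equal; ring.
Qed.

(** Fubini exchanges the two variables, and evenness of the kernel absorbs the resulting sign. *)
Lemma int_T_conv_sym p q : even U ->
  (forall x, continuous p x) -> (forall x, continuous q x) ->
  int_T (fun x => p x * conv U q x) = int_T (fun x => q x * conv U p x).
Proof.
  intros HU Hp Hq.
  assert (HPI : - PI <= PI) by (pose proof PI_RGT_0; lra).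
  transitivity (int_T (fun x => int_T (fun w => p x * (U (x - w) * q w)))).
  - apply int_T_ext; intros x; symmetry; apply int_T_scal; intros w; cont.
  - unfold int_T at 1 2; rewrite RInt_swap; [| exact HPI |].
    + apply int_T_ext; intros w.
      unfold conv; rewrite <- int_T_scal by (intros x; cont).
      apply int_T_ext; intros x.
      rewrite <- (HU (w - x)); replace (- (w - x)) with (x - w) by ring; ring.
    + intros x w; unfold continuous2; apply cont_mult; [cont | apply cont_mult; cont].
Qed.

End Convolution.

Lemma is_derive_conv (U dU q : R -> R) x :
  (forall y, is_derive U y (dU y)) -> (forall y, continuous dU y) ->
  (forall y, continuous q y) ->
  is_derive (conv U q) x (conv dU q x).
Proof.
  intros HU HdU Hq.
  assert (HUc : forall y, continuous U y) by (intros y; eapply is_derive_cont, HU).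
  apply (is_derive_RInt_param_cont (fun y w => U (y - w) * q w)
           (fun y w => dU (y - w) * q w)).
  - apply filter_forall; intros y w.
    replace (dU (y - w) * q w) with (q w * (1 * dU (y - w))) by ring.
    apply (is_derive_ext (fun u => q w * U (u - w))); [intros u; apply Rmult_comm |].
    apply (is_derive_scal (fun u => U (u - w))).
    apply (is_derive_comp (V := R_NormedModule) U); [apply HU | auto_derive; auto].
  - apply filter_forall; intros y w; cont.
  - intros w; unfold continuous2; apply cont_mult; cont.
Qed.

(** The Wronskian-like function f' e - f e' is periodic with derivative f'' e - f e'', the cross
    terms f' e' cancelling. *)
Lemma green_periodic (f df ddf e de dde : R -> R) :
  periodic f -> periodic df -> periodic e -> periodic de ->
  (forall x, is_derive f x (df x)) -> (forall x, is_derive df x (ddf x)) ->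
  (forall x, is_derive e x (de x)) -> (forall x, is_derive de x (dde x)) ->
  (forall x, continuous ddf x) -> (forall x, continuous dde x) ->
  int_T (fun x => ddf x * e x) = int_T (fun x => f x * dde x).
Proof.
  intros Pf Pdf Pe Pde Hf Hdf He Hde Cddf Cdde.
  assert (Cf : forall x, continuous f x) by (intros; eapply is_derive_cont, Hf).
  assert (Ce : forall x, continuous e x) by (intros; eapply is_derive_cont, He).
  assert (H : int_T (fun x => ddf x * e x + -1 * (f x * dde x)) = 0).
  { apply (int_T_derive_periodic (fun x => df x * e x - f x * de x)).
    - intros x; rewrite Pf, Pdf, Pe, Pde; reflexivity.
    - intros x.
      replace (ddf x * e x + -1 * (f x * dde x))
        with ((ddf x * e x + df x * de x) - (df x * de x + f x * dde x)) by ring.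
      apply (is_derive_minus (V := R_NormedModule));
        apply (is_derive_mult (K := R_AbsRing)); auto; intros; apply Rmult_comm.
    - intros x; cont. }
  rewrite int_T_plus, int_T_scal in H by (intros x; cont).
  lra.
Qed.


(** * The potential *)

Section Potential.
Variable Psi : R -> R.
Hypothesis Psi_cont : forall x, continuous Psi x.

Lemma is_derive_potential x : is_derive (potential Psi) x (Psi x).
Proof. apply is_derive_RInt_cont, Psi_cont. Qed.

(** The increment of the potential over one period is constant in [x], and at - PI it equals the
    mean of [Psi]. *)
Lemma potential_periodic : periodic Psi -> int_T Psi = 0 -> periodic (potential Psi).
Proof.
  intros Hp H0.
  pose (G := fun x => potential Psi (x + 2 * PI) - potential Psi x).
  assert (HG : forall x y, G x = G y).
  { apply is_derive_zero_eq; intros x.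
    replace 0 with (1 * Psi (x + 2 * PI) - Psi x) by (rewrite Hp; ring).
    apply (is_derive_minus (V := R_NormedModule)); [| apply is_derive_potential].
    apply (is_derive_comp (V := R_NormedModule) (potential Psi));
      [apply is_derive_potential | auto_derive; auto]. }
  intros x; specialize (HG x (- PI)); unfold G in HG.
  replace (- PI + 2 * PI) with PI in HG by ring.
  change (potential Psi PI) with (int_T Psi) in HG; rewrite H0 in HG.
  unfold potential at 3 in HG; rewrite RInt_point in HG.
  unfold zero in HG; simpl in HG; lra.
Qed.

Lemma potential_even : (forall x, Psi (- x) = - Psi x) -> even (potential Psi).
Proof.
  intros Ho x.
  pose (G := fun x => potential Psi (- x) - potential Psi x).
  assert (HG : G x = G 0).
  { apply is_derive_zero_eq; intros y.
    replace 0 with ((-1) * Psi (- y) - Psi y) by (rewrite Ho; ring).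
    apply (is_derive_minus (V := R_NormedModule)); [| apply is_derive_potential].
    apply (is_derive_comp (V := R_NormedModule) (potential Psi));
      [apply is_derive_potential | auto_derive; auto]. }
  unfold G in HG; rewrite Ropp_0 in HG; lra.
Qed.

Lemma Derive_n_potential n x : Derive_n (potential Psi) (S n) x = Derive_n Psi n x.
Proof.
  revert x; induction n as [| n IH]; intros x.
  - apply is_derive_unique, is_derive_potential.
  - apply Derive_ext, IH.
Qed.

Lemma potential_smooth : smooth_T Psi -> int_T Psi = 0 -> smooth_T (potential Psi).
Proof.
  intros [Hp Hs] H0; split; [apply potential_periodic; assumption |].
  intros [| [| n]] x; [exact I | eexists; apply is_derive_potential |].
  apply (ex_derive_ext (Derive_n Psi n)); [| exact (Hs (S n) x)].
  intros y; symmetry; apply Derive_n_potential.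
Qed.

End Potential.

(** * Fourier modes of the linearized equation *)

(** The phase lets one real family serve both parts of a Fourier coefficient: phases 0 and PI / 2
    give cos (l x) and - sin (l x), the parts of exp (- i l x). *)
Definition wave (l : Z) (phi x : R) : R := cos (IZR l * x + phi).

Lemma is_derive_wave l phi x :
  is_derive (wave l phi) x (- IZR l * sin (IZR l * x + phi)).
Proof. unfold wave; auto_derive; [auto | ring]. Qed.

Lemma is_derive_wave2 l phi x :
  is_derive (fun y => - IZR l * sin (IZR l * y + phi)) x (- IZR l ^ 2 * wave l phi x).
Proof. unfold wave; auto_derive; [auto | ring]. Qed.

Lemma cont_wave l phi x : continuous (wave l phi) x.
Proof. eapply is_derive_cont, is_derive_wave. Qed.

Lemma wave_periodic l phi : periodic (wave l phi).
Proof.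
  intros x; unfold wave.
  replace (IZR l * (x + 2 * PI) + phi)
    with (IZR l * x + phi + 2 * (IZR l * PI)) by ring.
  (* The double-angle forms are the ones expressed through sin (l PI), which vanishes. *)
  rewrite cos_plus, cos_2a_sin, sin_2a, (sin_eq_0_1 (IZR l * PI)) by (exists l; ring).
  ring.
Qed.

Lemma fourier_wave f l :
  fourier f l = (int_T (fun x => f x * wave l 0 x), int_T (fun x => f x * wave l (PI / 2) x)).
Proof.
  unfold fourier, int_T_C, wave; f_equal; apply int_T_ext; intros x;
    unfold Re, Im, RtoC, cis, Cmult; simpl.
  - rewrite cos_neg, Rplus_0_r; ring.
  - rewrite sin_neg, cos_plus, cos_PI2, sin_PI2; ring.
Qed.

(** With the integrating factor exp (mu s), the product is constant on positive times; time 1 is the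
    reference because nothing is known at 0. *)
Lemma linear_ode_exp (y : R -> R) (mu : R) :
  (forall t, 0 < t -> is_derive y t (- mu * y t)) ->
  forall t, 0 < t -> y t = exp (- mu * t) * (exp mu * y 1).
Proof.
  intros Hy t Ht.
  set (z := fun s => exp (mu * s) * y s).
  assert (Hz : forall s, 0 < s -> is_derive z s 0).
  { intros s Hs; pose proof (Hy s Hs) as Hd; unfold z.
    auto_derive; [eexists; exact Hd |].
    change (fun x => y x) with y.
    rewrite (is_derive_unique _ _ _ Hd); ring. }
  assert (E : z t = z 1).
  { destruct (Rtotal_order t 1) as [H | [-> | H]]; [| reflexivity | symmetry];
      apply (eq_is_derive (V := R_NormedModule) z); try exact H;
      intros s Hs; apply Hz; lra. }
  unfold z in E; rewrite Rmult_1_r in E; rewrite <- E, <- Rmult_assoc, <- exp_plus.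
  replace (- mu * t + mu * t) with 0 by ring; rewrite exp_0; ring.
Qed.

Section Modes.
Variables (U dU ddU : R -> R) (kappa nu : R) (l : Z).
Hypothesis U_periodic : periodic U.
Hypothesis U_even : even U.
Hypothesis U_derive : forall x, is_derive U x (dU x).
Hypothesis dU_derive : forall x, is_derive dU x (ddU x).
Hypothesis ddU_cont : forall x, continuous ddU x.

Let U_cont x : continuous U x := is_derive_cont _ _ _ (U_derive x).
Let dU_cont x : continuous dU x := is_derive_cont _ _ _ (dU_derive x).

Let dU_periodic : periodic dU.
Proof.
  intros x; rewrite <- (is_derive_unique _ _ _ (U_derive x)).
  rewrite <- (is_derive_unique _ _ _ (U_derive (x + 2 * PI))).
  apply Derive_periodic, U_periodic.
Qed.

(** Sign convention: modes evolve like exp (- rate t), so a positive value means decay. *)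
Definition rate : R :=
  IZR l ^ 2 * (kappa / (2 * PI) * Re (fourier U l) + nu).

(** Expanding cos ((l x + phi) - l v) leaves a cosine integral, the real part of the coefficient,
    and a sine integral that vanishes because [U] is even. *)
Lemma conv_wave phi x : conv U (wave l phi) x = Re (fourier U l) * wave l phi x.
Proof.
  rewrite fourier_wave; simpl.
  rewrite conv_comm by (auto using cont_wave, wave_periodic).
  transitivity (int_T (fun v => wave l phi x * (U v * wave l 0 v)
                  + sin (IZR l * x + phi) * (U v * sin (IZR l * v)))).
  - apply int_T_ext; intros v; unfold wave.
    replace (IZR l * (x - v) + phi) with ((IZR l * x + phi) - IZR l * v) by ring.
    rewrite cos_minus, Rplus_0_r; ring.
  - rewrite int_T_plus, !int_T_scal by (intros v; pose proof (cont_wave l 0); cont).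
    rewrite (int_T_odd (fun v => U v * sin (IZR l * v))).
    + ring.
    + intros v; cont.
    + intros v; rewrite U_even.
      replace (IZR l * - v) with (- (IZR l * v)) by ring; rewrite sin_neg; ring.
Qed.

Lemma Derive_conv_Derive (q : R -> R) x : (forall y, continuous q y) ->
  Derive (conv (Derive U) q) x = conv ddU q x.
Proof.
  intros Hq.
  rewrite (Derive_ext _ (conv dU q)).
  - apply is_derive_unique, is_derive_conv; auto.
  - intros y; apply int_T_ext; intros w.
    now rewrite (is_derive_unique _ _ _ (U_derive (y - w))).
Qed.

(** Two differentiations of the eigenfunction identity [conv_wave]; used to check that the separated
    solution solves the equation. *)
Lemma conv_ddU_wave phi x :
  conv ddU (wave l phi) x = - IZR l ^ 2 * (Re (fourier U l) * wave l phi x).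
Proof.
  set (u := Re (fourier U l)).
  assert (H1 : forall y, conv dU (wave l phi) y = u * (- IZR l * sin (IZR l * y + phi))).
  { intros y.
    rewrite <- (is_derive_unique _ _ _
      (is_derive_conv U dU (wave l phi) y U_derive dU_cont (cont_wave l phi))).
    rewrite (Derive_ext _ _ y (conv_wave phi)).
    apply is_derive_unique, (is_derive_scal (wave l phi)), is_derive_wave. }
  rewrite <- (is_derive_unique _ _ _
    (is_derive_conv dU ddU (wave l phi) x dU_derive ddU_cont (cont_wave l phi))).
  rewrite (Derive_ext _ _ x H1).
  replace (- IZR l ^ 2 * (u * wave l phi x)) with (u * (- IZR l ^ 2 * wave l phi x)) by ring.
  apply is_derive_unique, is_derive_scal, is_derive_wave2.
Qed.

(* Green's formula moves both angular derivatives onto the wave, and the wave is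
   an eigenfunction of the self-adjoint operator [conv U]. *)
Lemma is_derive_mode h phi t : linearized_solution kappa nu U h -> 0 < t ->
  is_derive (fun s => int_T (fun x => h s x * wave l phi x)) t
    (- rate * int_T (fun x => h t x * wave l phi x)).
Proof.
  intros [Hp [Hreg Heq]] Ht.
  pose proof (cont_wave l phi) as Cw.
  assert (Hpos : locally t (fun s => 0 < s)) by (apply open_gt; exact Ht).
  assert (Ch : forall s, 0 < s -> forall x, continuous (h s) x).
  { intros s Hs x; apply continuous2_slice_r, continuous2_2d_pt, Hreg, Hs. }
  assert (Cht : forall x, continuous2 (fun s y => Derive (fun r => h r y) s) t x).
  { intros x; apply continuous2_2d_pt, Hreg, Ht. }
  assert (Cxx : forall x, continuous (Derive_n (h t) 2) x).
  { intros x.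
    apply (continuous2_slice_r (fun s y => Derive_n (h s) 2 y)), continuous2_2d_pt, Hreg, Ht. }
  replace (- rate * int_T (fun x => h t x * wave l phi x))
    with (int_T (fun x => Derive (fun s => h s x) t * wave l phi x)).
  - apply (is_derive_RInt_param_cont (fun s x => h s x * wave l phi x)
             (fun s x => Derive (fun r => h r x) s * wave l phi x)).
    + generalize Hpos; apply filter_imp; intros s Hs x.
      replace (Derive (fun r => h r x) s * wave l phi x)
        with (wave l phi x * Derive (fun r => h r x) s) by ring.
      apply (is_derive_ext (fun r => wave l phi x * h r x));
        [intros r; apply Rmult_comm |].
      apply (is_derive_scal (fun r => h r x)), Derive_correct.
      apply (Hreg s x Hs).
    + generalize Hpos; apply filter_imp; intros s Hs x; pose proof (Ch s Hs); cont.
    + intros x; apply cont_mult; [apply Cht | cont].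
  - set (m := int_T (fun x => h t x * wave l phi x)).
    assert (Cc : forall x, continuous (conv ddU (h t)) x).
    { intros x; apply continuous_conv; auto. }
    assert (CU : forall x, continuous (conv U (h t)) x).
    { intros x; apply continuous_conv; auto. }
    pose proof (Ch t Ht) as Cht'.
    assert (Pd : periodic (fun y => - IZR l * sin (IZR l * y + phi))).
    { intros x; rewrite <- (is_derive_unique _ _ _ (is_derive_wave l phi x)).
      rewrite <- (is_derive_unique _ _ _ (is_derive_wave l phi (x + 2 * PI))).
      apply Derive_periodic, wave_periodic. }
    assert (Hdiff : int_T (fun x => Derive_n (h t) 2 x * wave l phi x) = - IZR l ^ 2 * m).
    { rewrite (green_periodic (h t) (Derive (h t)) (Derive_n (h t) 2) (wave l phi)
                 (fun y => - IZR l * sin (IZR l * y + phi))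
                 (fun y => - IZR l ^ 2 * wave l phi y));
        auto using wave_periodic, is_derive_wave, is_derive_wave2.
      - unfold m; rewrite <- int_T_scal by (intros x; cont).
        apply int_T_ext; intros x; ring.
      - apply Derive_periodic, Hp, Ht.
      - intros x; apply Derive_correct; exact (proj1 (proj2 (proj2 (Hreg t x Ht)))).
      - intros x; apply Derive_correct; exact (proj1 (proj2 (proj2 (proj2 (Hreg t x Ht))))).
      - intros x; cont. }
    assert (Hconv : int_T (fun x => conv ddU (h t) x * wave l phi x)
                    = - IZR l ^ 2 * (Re (fourier U l) * m)).
    { rewrite (green_periodic (conv U (h t)) (conv dU (h t)) (conv ddU (h t)) (wave l phi)
                 (fun y => - IZR l * sin (IZR l * y + phi))
                 (fun y => - IZR l ^ 2 * wave l phi y));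
        auto using wave_periodic, is_derive_wave, is_derive_wave2,
                   conv_periodic, is_derive_conv.
      - transitivity (int_T (fun x => - IZR l ^ 2 * (wave l phi x * conv U (h t) x))).
        { apply int_T_ext; intros x; ring. }
        rewrite int_T_scal by (intros x; cont); f_equal.
        rewrite int_T_conv_sym by auto.
        unfold m; rewrite <- int_T_scal by (intros x; cont).
        apply int_T_ext; intros x; rewrite conv_wave; ring.
      - intros x; cont. }
    transitivity (int_T (fun x => kappa / (2 * PI) * (conv ddU (h t) x * wave l phi x)
                                  + nu * (Derive_n (h t) 2 x * wave l phi x))).
    + apply int_T_ext; intros x.
      pose proof (Heq t x Ht) as E; rewrite Derive_conv_Derive in E by auto.
      replace (Derive (fun s => h s x) t)
        with (kappa / (2 * PI) * conv ddU (h t) x + nu * Derive_n (h t) 2 x) by lra.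
      ring.
    + rewrite int_T_plus, !int_T_scal, Hdiff, Hconv by (intros x; cont).
      unfold rate; ring.
Qed.

(** An exact identity, rather than a bound, gives both decay and growth and shows that a mode
    present at one time is present at time 1. *)
Lemma fourier_linearized h t : linearized_solution kappa nu U h -> 0 < t ->
  fourier (h t) l = (exp (- rate * t) * (exp rate * fourier (h 1) l))%C.
Proof.
  intros Hh Ht; rewrite !fourier_wave.
  rewrite (linear_ode_exp (fun s => int_T (fun x => h s x * wave l 0 x)) rate)
    by (auto using is_derive_mode).
  rewrite (linear_ode_exp (fun s => int_T (fun x => h s x * wave l (PI / 2) x)) rate)
    by (auto using is_derive_mode).
  unfold RtoC, Cmult; simpl; f_equal; ring.
Qed.

Lemma Cmod_fourier_linearized h t : linearized_solution kappa nu U h -> 0 < t ->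
  Cmod (fourier (h t) l) = exp rate * Cmod (fourier (h 1) l) * exp (- rate * t).
Proof.
  intros Hh Ht; rewrite (fourier_linearized h t Hh Ht), !Cmod_mult, !Cmod_R.
  rewrite !Rabs_pos_eq by (left; apply exp_pos); ring.
Qed.

Lemma mode_decays h : 0 < rate -> linearized_solution kappa nu U h ->
  decays_exponentially (fun t => fourier (h t) l).
Proof.
  intros Hr Hh; exists (exp rate * Cmod (fourier (h 1) l)), rate.
  split; [exact Hr |].
  intros t Ht; right; apply Cmod_fourier_linearized; assumption.
Qed.

(** Separated solution witnessing the existence half of [growing_mode]. *)
Lemma linearized_solution_wave :
  linearized_solution kappa nu U (fun t x => exp (- rate * t) * wave l 0 x).
Proof.
  set (E := fun t => exp (- rate * t)).
  assert (HE : forall t, is_derive E t (- rate * E t)).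
  { intros t; unfold E; auto_derive; [auto | ring]. }
  assert (CE : forall t, continuous E t) by (intros t; eapply is_derive_cont, HE).
  pose proof (cont_wave l 0) as Cw.
  assert (Dt : forall t x, is_derive (fun s => E s * wave l 0 x) t (- rate * E t * wave l 0 x)).
  { intros t x.
    replace (- rate * E t * wave l 0 x) with (wave l 0 x * (- rate * E t)) by ring.
    apply (is_derive_ext (fun s => wave l 0 x * E s)); [intros s; apply Rmult_comm |].
    apply (is_derive_scal E), HE. }
  assert (Dx : forall t x, is_derive (fun y => E t * wave l 0 y) x
                 (E t * (- IZR l * sin (IZR l * x + 0)))).
  { intros t x; apply (is_derive_scal (wave l 0)), is_derive_wave. }
  assert (Dxx : forall t x, is_derive (Derive (fun y => E t * wave l 0 y)) x
                 (E t * (- IZR l ^ 2 * wave l 0 x))).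
  { intros t x.
    apply (is_derive_ext (fun y => E t * (- IZR l * sin (IZR l * y + 0)))).
    { intros y; symmetry; apply is_derive_unique, Dx. }
    apply is_derive_scal, is_derive_wave2. }
  change (linearized_solution kappa nu U (fun t x => E t * wave l 0 x)).
  split; [| split].
  - intros t _ x; rewrite wave_periodic; reflexivity.
  - intros t x _; rewrite <- !continuous2_2d_pt; repeat split.
    + unfold continuous2; cont.
    + eexists; apply Dt.
    + eexists; apply Dx.
    + eexists; apply Dxx.
    + apply (continuous_ext (fun z : R * R => - rate * E (fst z) * wave l 0 (snd z))).
      { intros z; symmetry; apply is_derive_unique, Dt. }
      cont.
    + apply (continuous_ext (fun z : R * R => E (fst z) * (- IZR l ^ 2 * wave l 0 (snd z)))).
      { intros z; symmetry; apply is_derive_unique, Dxx. }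
      cont.
  - intros t x _.
    rewrite Derive_conv_Derive by (intros y; cont).
    replace (Derive (fun s => E s * wave l 0 x) t) with (- rate * E t * wave l 0 x)
      by (symmetry; apply is_derive_unique, Dt).
    replace (Derive_n (fun y => E t * wave l 0 y) 2 x) with (E t * (- IZR l ^ 2 * wave l 0 x))
      by (symmetry; apply is_derive_unique, Dxx).
    replace (conv ddU (fun y => E t * wave l 0 y) x) with (E t * conv ddU (wave l 0) x).
    + rewrite conv_ddU_wave; unfold rate; ring.
    + unfold conv; rewrite <- int_T_scal by (intros w; cont).
      apply int_T_ext; intros w; ring.
Qed.

(** Ensures that the separated solution really carries the mode [l]. *)
Lemma int_T_wave_sqr : l <> 0%Z -> int_T (fun x => wave l 0 x * wave l 0 x) = PI.
Proof.
  intros Hl.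
  assert (Hl' : IZR l <> 0) by (apply not_0_IZR; exact Hl).
  pose proof (cont_wave l 0) as Cw.
  assert (H : int_T (fun x => 2 * (wave l 0 x * wave l 0 x) + - (1)) = 0).
  (* The antiderivative cos sin / l of 2 cos^2 - 1 is written as the wave times its derivative,
     divided by - l^2, so that it inherits periodicity from both factors. *)
  { apply (int_T_derive_periodic
             (fun x => wave l 0 x * (- IZR l * sin (IZR l * x + 0)) * (- / IZR l ^ 2))).
    - intros x; rewrite wave_periodic; f_equal; f_equal.
      rewrite <- (is_derive_unique _ _ _ (is_derive_wave l 0 x)).
      rewrite <- (is_derive_unique _ _ _ (is_derive_wave l 0 (x + 2 * PI))).
      apply Derive_periodic, wave_periodic.
    - intros x; unfold wave; auto_derive; [auto |].
      rewrite !Rplus_0_r.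
      pose proof (sin2_cos2 (IZR l * x)) as Hsc; unfold Rsqr in Hsc.
      transitivity (cos (IZR l * x) * cos (IZR l * x) - sin (IZR l * x) * sin (IZR l * x));
        [| lra].
      field; exact Hl'.
    - intros x; cont. }
  rewrite int_T_plus, int_T_scal in H by (intros x; cont).
  unfold int_T at 2 in H; rewrite (RInt_const (V := R_CompleteNormedModule)) in H.
  unfold scal in H; simpl in H; unfold mult in H; simpl in H; lra.
Qed.

Lemma mode_grows : l <> 0%Z -> rate < 0 -> growing_mode kappa nu U l.
Proof.
  intros Hl Hr; split.
  - exists (fun t x => exp (- rate * t) * wave l 0 x).
    split; [exact linearized_solution_wave |].
    exists 1; split; [lra |].
    rewrite fourier_wave; intros E; apply (f_equal Re) in E; simpl in E.
    pose proof (cont_wave l 0) as Cw.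
    rewrite (int_T_ext _ (fun x => exp (- rate * 1) * (wave l 0 x * wave l 0 x))) in E
      by (intros x; ring).
    rewrite int_T_scal, int_T_wave_sqr in E by (assumption || cont).
    apply Rmult_integral in E; pose proof PI_RGT_0; pose proof (exp_pos (- rate * 1)); lra.
  - intros h Hh [t [Ht Hm]].
    exists (exp rate * Cmod (fourier (h 1) l)), (- rate).
    split; [| split; [lra |]].
    (* A coefficient vanishing at time 1 would vanish at all positive times, against the mode at
       [t]. *)
    + apply Rmult_lt_0_compat; [apply exp_pos |].
      apply Cmod_gt_0; intros E; apply Hm.
      rewrite (fourier_linearized h t Hh Ht), E; ring.
    + intros s Hs; right; symmetry; apply Cmod_fourier_linearized; assumption.
Qed.

End Modes.


(** * Free energy *)

Section TimeDerivatives.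
Variables (D : R -> Prop) (g gt : R -> R -> R).
Hypothesis D_open : forall t, D t -> locally t D.
Hypothesis g_cont : forall t, D t -> forall x, continuous2 g t x.
Hypothesis gt_cont : forall t, D t -> forall x, continuous2 gt t x.
Hypothesis g_derive : forall t, D t -> forall x, is_derive (fun s => g s x) t (gt t x).

Lemma is_derive_conv_time U t x : (forall y, continuous U y) -> D t ->
  is_derive (fun s => conv U (g s) x) t (conv U (gt t) x).
Proof.
  intros HU Ht.
  apply (is_derive_RInt_param_cont (fun s w => U (x - w) * g s w)
           (fun s w => U (x - w) * gt s w)).
  - generalize (D_open t Ht); apply filter_imp; intros s Hs w.
    apply (is_derive_scal (fun s => g s w)), g_derive, Hs.
  - generalize (D_open t Ht); apply filter_imp; intros s Hs w.
    apply cont_mult; [cont | apply continuous2_slice_r, g_cont, Hs].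
  - intros w; apply cont_mult; [cont | apply gt_cont, Ht].
Qed.

(** The product rule gives two terms that agree by symmetry of the kernel; the factor 2 cancels the
    1/2 in the free energy. *)
Lemma is_derive_interaction U t : (forall y, continuous U y) -> even U -> D t ->
  is_derive (fun s => int_T (fun x => int_T (fun w => U (x - w) * g s x * g s w))) t
    (2 * int_T (fun x => gt t x * conv U (g t) x)).
Proof.
  intros HU Ue Ht.
  assert (Cg : forall s, D s -> forall x, continuous (g s) x).
  { intros s Hs x; apply continuous2_slice_r, g_cont, Hs. }
  assert (Cgt : forall s, D s -> forall x, continuous (gt s) x).
  { intros s Hs x; apply continuous2_slice_r, gt_cont, Hs. }
  assert (Cc : forall s, D s -> forall x, continuous (conv U (g s)) x).
  { intros s Hs x; apply continuous_conv; auto. }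
  assert (Cct : forall s, D s -> forall x, continuous (conv U (gt s)) x).
  { intros s Hs x; apply continuous_conv; auto. }
  apply (is_derive_ext_loc (fun s => int_T (fun x => g s x * conv U (g s) x))).
  { generalize (D_open t Ht); apply filter_imp; intros s Hs.
    apply int_T_ext; intros x; unfold conv.
    pose proof (Cg s Hs) as Cgs.
    rewrite <- int_T_scal by (intros w; cont).
    apply int_T_ext; intros w; ring. }
  replace (2 * int_T (fun x => gt t x * conv U (g t) x))
    with (int_T (fun x => gt t x * conv U (g t) x + g t x * conv U (gt t) x)).
  - apply (is_derive_RInt_param_cont (fun s x => g s x * conv U (g s) x)
             (fun s x => gt s x * conv U (g s) x + g s x * conv U (gt s) x)).
    + generalize (D_open t Ht); apply filter_imp; intros s Hs x.
      apply (is_derive_mult (K := R_AbsRing) (fun s => g s x) (fun s => conv U (g s) x)).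
      * apply g_derive, Hs.
      * apply is_derive_conv_time; assumption.
      * intros; apply Rmult_comm.
    + generalize (D_open t Ht); apply filter_imp; intros s Hs x.
      pose proof (Cg s Hs); pose proof (Cc s Hs); cont.
    + intros x; apply cont_plus; apply cont_mult.
      * apply gt_cont, Ht.
      * apply (continuous_conv_param U HU g).
        generalize (D_open t Ht); apply filter_imp; auto.
      * apply g_cont, Ht.
      * apply (continuous_conv_param U HU gt).
        generalize (D_open t Ht); apply filter_imp; auto.
  - pose proof (Cg t Ht); pose proof (Cgt t Ht); pose proof (Cc t Ht); pose proof (Cct t Ht).
    rewrite int_T_plus by (intros x; cont).
    rewrite (int_T_conv_sym U HU (g t) (gt t)) by auto; ring.
Qed.

Lemma is_derive_entropy t : (forall s, D s -> forall x, 0 < g s x) -> D t ->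
  is_derive (fun s => int_T (fun x => g s x * ln (g s x))) t
    (int_T (fun x => gt t x * (ln (g t x) + 1))).
Proof.
  intros Hpos Ht.
  assert (Cln : forall s, D s -> forall x, continuous2 (fun s x => ln (g s x)) s x).
  { intros s Hs x; apply (cont_ln (fun z : R * R => g (fst z) (snd z))).
    - apply Hpos, Hs.
    - apply g_cont, Hs. }
  apply (is_derive_RInt_param_cont (fun s x => g s x * ln (g s x))
           (fun s x => gt s x * (ln (g s x) + 1))).
  - generalize (D_open t Ht); apply filter_imp; intros s Hs x.
    pose proof (g_derive s Hs x) as Hd; pose proof (Hpos s Hs x) as Hp.
    auto_derive; [repeat split; auto; eexists; exact Hd |].
    replace (Derive (fun s => g s x) s) with (gt s x)
      by (symmetry; apply is_derive_unique, Hd).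
    field; apply Rgt_not_eq, Hp.
  - generalize (D_open t Ht); apply filter_imp; intros s Hs x.
    apply cont_mult; [apply continuous2_slice_r, g_cont, Hs |].
    apply (continuous2_slice_r (fun s x => ln (g s x))), Cln, Hs.
  - intros x; apply cont_mult; [apply gt_cont, Ht |].
    apply cont_plus; [apply Cln, Ht | apply continuous_const].
Qed.

End TimeDerivatives.

(** A fixed-time identity: the time derivative has already been replaced through (E), so only the
    angle remains. *)
Lemma energy_identity (kappa nu : R) (U Psi dPsi G dG ddG : R -> R) :
  periodic U -> periodic Psi -> periodic G ->
  (forall x, is_derive U x (Psi x)) ->
  (forall x, is_derive Psi x (dPsi x)) -> (forall x, continuous dPsi x) ->
  (forall x, 0 < G x) ->
  (forall x, is_derive G x (dG x)) -> (forall x, is_derive dG x (ddG x)) ->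
  (forall x, continuous ddG x) ->
  int_T (fun x => (kappa * Derive (fun y => G y * conv Psi G y) x + nu * ddG x)
                  * (nu * (ln (G x) + 1) + kappa * conv U G x))
  = - dissipation kappa nu Psi G.
Proof.
  intros PU PPsi PG HU HPsi CdPsi Hpos HG HdG CddG.
  assert (CPsi : forall x, continuous Psi x) by (intros; eapply is_derive_cont, HPsi).
  assert (CU : forall x, continuous U x) by (intros; eapply is_derive_cont, HU).
  assert (CG : forall x, continuous G x) by (intros; eapply is_derive_cont, HG).
  assert (CdG : forall x, continuous dG x) by (intros; eapply is_derive_cont, HdG).
  assert (HUG : forall x, is_derive (conv U G) x (conv Psi G x))
    by (intros; apply is_derive_conv; auto).
  assert (HPG : forall x, is_derive (conv Psi G) x (conv dPsi G x))
    by (intros; apply is_derive_conv; auto).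
  assert (CdPG : forall x, continuous (conv dPsi G) x)
    by (intros; apply continuous_conv; auto).
  assert (CPG : forall x, continuous (conv Psi G) x)
    by (intros; apply continuous_conv; auto).
  assert (CUG : forall x, continuous (conv U G) x)
    by (intros; apply continuous_conv; auto).
  assert (PdG : periodic dG).
  { intros x; rewrite <- (is_derive_unique _ _ _ (HG x)).
    rewrite <- (is_derive_unique _ _ _ (HG (x + 2 * PI))).
    apply Derive_periodic, PG. }
  assert (HlnG : forall x, is_derive (fun y => ln (G y)) x (dG x / G x)).
  { intros x; pose proof (Hpos x) as Hp; pose proof (HG x) as Hd.
    auto_derive; [repeat split; auto; eexists; exact Hd |].
    change (fun x => G x) with G; rewrite (is_derive_unique _ _ _ Hd); field; lra. }
  assert (ClnG : forall x, continuous (fun y => ln (G y)) x)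
    by (intros; eapply is_derive_cont, HlnG).
  (* [p] is J' written out with explicit derivatives, which makes its continuity visible. *)
  set (p := fun x => kappa * (dG x * conv Psi G x + G x * conv dPsi G x) + nu * ddG x).
  set (L := fun x => nu * (ln (G x) + 1) + kappa * conv U G x).
  set (J := fun x => kappa * (G x * conv Psi G x) + nu * dG x).
  set (dL := fun x => nu * (dG x / G x) + kappa * conv Psi G x).
  assert (HGPG : forall x, is_derive (fun y => G y * conv Psi G y) x
                   (dG x * conv Psi G x + G x * conv dPsi G x)).
  { intros x; apply (is_derive_mult (K := R_AbsRing)); auto; intros; apply Rmult_comm. }
  assert (HJ : forall x, is_derive J x (p x)).
  { intros x; apply (is_derive_plus (V := R_NormedModule)); apply is_derive_scal; auto. }
  assert (HL : forall x, is_derive L x (dL x)).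
  { intros x; apply (is_derive_plus (V := R_NormedModule)); apply is_derive_scal; auto.
    replace (dG x / G x) with (dG x / G x + 0) by ring.
    apply (is_derive_plus (V := R_NormedModule)); [apply HlnG | apply @is_derive_const]. }
  assert (CL : forall x, continuous L x) by (intros; eapply is_derive_cont, HL).
  assert (CJ : forall x, continuous J x) by (intros; eapply is_derive_cont, HJ).
  assert (Cp : forall x, continuous p x).
  { intros x; unfold p; cont. }
  (* Since G (log G)' = G', the flux is G times L': this gradient-flow structure turns J L' into a
     weighted square. *)
  assert (HJL : forall x, J x = G x * dL x).
  { intros x; unfold J, dL; field; pose proof (Hpos x); lra. }
  assert (CdL : forall x, continuous dL x).
  { intros x; unfold dL, Rdiv.
    apply cont_plus; [| cont].
    apply cont_mult; [cont |]; apply cont_mult; [cont |].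
    apply cont_inv; [apply Rgt_not_eq, Hpos | apply CG]. }
  assert (E : int_T (fun x => p x * L x + J x * dL x) = 0).
  { apply (int_T_derive_periodic (fun x => J x * L x)).
    - intros x; unfold J, L.
      rewrite PG, PdG, (conv_periodic U G PU), (conv_periodic Psi G PPsi); reflexivity.
    - intros x; apply (is_derive_mult (K := R_AbsRing)); auto; intros; apply Rmult_comm.
    - intros x; cont. }
  rewrite int_T_plus in E by (intros x; cont).
  transitivity (int_T (fun x => p x * L x)).
  - apply int_T_ext; intros x; unfold p, L; f_equal; f_equal; f_equal.
    apply is_derive_unique, HGPG.
  - unfold dissipation.
    transitivity (- int_T (fun x => J x * dL x)); [lra | f_equal; apply int_T_ext].
    intros x; rewrite pow2_abs, HJL.
    replace (Derive (fun y => ln (G y)) x) with (dG x / G x)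
      by (symmetry; apply is_derive_unique, HlnG).
    unfold dL; ring.
Qed.

(** The integrand is visibly nonnegative; the work lies in its integrability, obtained by replacing
    (log G)' with G' / G. *)
Lemma dissipation_nonneg kappa nu Psi G : (forall x, continuous Psi x) ->
  (forall x, 0 < G x) -> (forall x, ex_derive G x) -> (forall x, continuous (Derive G) x) ->
  0 <= dissipation kappa nu Psi G.
Proof.
  intros CPsi Hpos HG CdG.
  assert (CG : forall x, continuous G x) by (intros; apply @ex_derive_continuous, HG).
  assert (CPG : forall x, continuous (conv Psi G) x)
    by (intros; apply continuous_conv; auto).
  apply RInt_ge_0.
  - pose proof PI_RGT_0; lra.
  - apply ex_RInt_cont; intros x.
    apply (continuous_ext
             (fun x => G x * (nu * (Derive G x * / G x) + kappa * conv Psi G x) ^ 2)).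
    + intros y; rewrite pow2_abs.
      replace (Derive (fun x => ln (G x)) y) with (Derive G y * / G y); [reflexivity |].
      symmetry; apply is_derive_unique.
      pose proof (Hpos y); pose proof (HG y).
      auto_derive; [auto | change (fun x => G x) with G; field; lra].
    + apply cont_mult; [cont |].
      apply (cont_comp (fun u => u ^ 2)).
      { intros y; apply @ex_derive_continuous; auto_derive; auto. }
      apply cont_plus; [| cont].
      apply cont_mult; [cont |]; apply cont_mult; [cont |].
      apply cont_inv; [apply Rgt_not_eq, Hpos | apply CG].
  - intros x _; apply Rmult_le_pos; [left; apply Hpos | rewrite pow2_abs; apply pow2_ge_0].
Qed.

Lemma in_time_open a b t : in_time a b t -> locally t (in_time a b).
Proof.
  intros [Ha Hb]; apply filter_and.
  - exact (open_Rbar_gt a t Ha).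
  - exact (open_Rbar_lt b t Hb).
Qed.

Lemma is_derive_free_energy kappa nu Phi Psi a b g t :
  smooth_T Psi -> (forall x, Psi (- x) = - Psi x) -> int_T Psi = 0 ->
  int_T2 Phi = 1 ->
  regular_positive_solution_E kappa nu Phi Psi a b g -> in_time a b t ->
  is_derive (fun s => free_energy kappa nu (potential Psi) (g s)) t
    (- dissipation kappa nu Psi (g t)).
Proof.
  intros [PPsi SPsi] Podd P0 Hmass [Gp [Gd [Gpos Geq]]] Ht.
  assert (DPsi : forall x, is_derive Psi x (Derive Psi x)).
  { intros x; apply Derive_correct, (SPsi 1%nat). }
  assert (CPsi : forall x, continuous Psi x) by (intros; eapply is_derive_cont, DPsi).
  assert (CdPsi : forall x, continuous (Derive Psi) x).
  { intros x; apply @ex_derive_continuous, (SPsi 2%nat). }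
  assert (DU : forall x, is_derive (potential Psi) x (Psi x)).
  { intros x; apply is_derive_potential, CPsi. }
  assert (CU : forall x, continuous (potential Psi) x) by (intros; eapply is_derive_cont, DU).
  pose proof (potential_even Psi CPsi Podd) as EU.
  set (gt := fun s x => Derive (fun r => g r x) s).
  assert (Cg : forall s, in_time a b s -> forall x, continuous2 g s x).
  { intros s Hs x; apply continuous2_2d_pt; exact (proj1 (Gd s x Hs)). }
  assert (Cgt : forall s, in_time a b s -> forall x, continuous2 gt s x).
  { intros s Hs x; apply continuous2_2d_pt.
    destruct (Gd s x Hs) as [_ [_ [_ [H _]]]]; exact (proj1 H). }
  assert (Dt : forall s, in_time a b s -> forall x, is_derive (fun r => g r x) s (gt s x)).
  { intros s Hs x; apply Derive_correct; exact (proj1 (proj2 (Gd s x Hs))). }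
  assert (Dx : forall x, is_derive (g t) x (Derive (g t) x)).
  { intros x; apply Derive_correct; exact (proj1 (proj2 (proj2 (Gd t x Ht)))). }
  assert (Dxx : forall x, is_derive (Derive (g t)) x (Derive_n (g t) 2 x)).
  { intros x; apply Derive_correct.
    destruct (Gd t x Ht) as [_ [_ [_ [_ H]]]]; exact (proj1 (proj2 (proj2 H))). }
  assert (Cxx : forall x, continuous (Derive_n (g t) 2) x).
  (* [ex_diff_n] lists continuity, the two partial differentiabilities, then the time and angular
     branches; taking the angular branch twice reaches the second angular derivative. *)
  { intros x; destruct (Gd t x Ht) as [_ [_ [_ [_ [_ [_ [_ [_ H]]]]]]]].
    apply (continuous2_slice_r (fun s y => Derive_n (g s) 2 y)), continuous2_2d_pt.
    exact (proj1 H). }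
  assert (Cgtx : forall x, continuous (gt t) x).
  { intros x; apply continuous2_slice_r, Cgt, Ht. }
  assert (CK : forall x, continuous (conv (potential Psi) (g t)) x).
  { intros x; apply continuous_conv; [exact CU |]; intros y.
    apply continuous2_slice_r, Cg, Ht. }
  assert (Cln : forall x, continuous (fun y => ln (g t y)) x).
  { intros x; apply cont_ln; [apply Gpos, Ht | apply continuous2_slice_r, Cg, Ht]. }
  replace (- dissipation kappa nu Psi (g t))
    with (nu * int_T (fun x => gt t x * (ln (g t x) + 1))
          + kappa / 2 * (2 * int_T (fun x => gt t x * conv (potential Psi) (g t) x))).
  - apply (is_derive_plus (V := R_NormedModule)); apply is_derive_scal.
    + apply (is_derive_entropy (in_time a b)); auto using in_time_open.
    + apply (is_derive_interaction (in_time a b)); auto using in_time_open.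
  - rewrite <- (energy_identity kappa nu (potential Psi) Psi (Derive Psi) (g t)
                  (Derive (g t)) (Derive_n (g t) 2)); auto using potential_periodic.
    transitivity (int_T (fun x => nu * (gt t x * (ln (g t x) + 1))
                           + kappa * (gt t x * conv (potential Psi) (g t) x))).
    + rewrite int_T_plus, !int_T_scal by (intros x; cont); field.
    + apply int_T_ext; intros x.
      pose proof (Geq t x Ht) as E; rewrite Hmass in E; fold (gt t x) in E.
      replace (kappa * Derive (fun y => g t y * conv Psi (g t) y) x
               + nu * Derive_n (g t) 2 x) with (gt t x) by lra.
      ring.
Qed.

Theorem theorem1p2 (kappa nu : R) (Phi : R -> R -> R) (Psi psi : R -> R)
  (kappa_pos : 0 < kappa) (nu_pos : 0 < nu)
  (Phi_smooth : smooth_T2 Phi) (Phi_even : even2 Phi)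
  (Phi_mass : int_T2 Phi = 1)
  (Psi_smooth : smooth_T Psi)
  (Psi_eq : forall theta, Psi theta = sin theta * psi theta)
  (psi_smooth : smooth_T psi) (psi_even : even psi)
  (psi_nonneg : forall theta, 0 <= psi theta)
  (Psi_mean : int_T Psi = 0) :
  let U := potential Psi in
  smooth_T U /\
  (forall (a b : Rbar) (g : R -> R -> R),
     regular_positive_solution_E kappa nu Phi Psi a b g ->
     forall t, in_time a b t ->
       is_derive (fun s => free_energy kappa nu U (g s)) t
         (- dissipation kappa nu Psi (g t)) /\
       - dissipation kappa nu Psi (g t) <= 0) /\
  (Rbar_lt
     (Lub_Rbar (fun x => exists l : Z, l <> 0%Z /\
        x = kappa / (2 * PI) * Cmod (fourier U l)))
     nu ->
   linearly_stable kappa nu U) /\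
  ((exists l : Z, l <> 0%Z /\
      - (kappa / (2 * PI)) * Re (fourier U l) > nu) ->
   linearly_unstable kappa nu U).
Proof.
  intros U.
  assert (Psi_odd : forall x, Psi (- x) = - Psi x).
  { intros x; rewrite !Psi_eq, psi_even, sin_neg; ring. }
  assert (DPsi : forall x, is_derive Psi x (Derive Psi x)).
  { intros x; apply Derive_correct, (proj2 Psi_smooth 1%nat). }
  assert (CPsi : forall x, continuous Psi x) by (intros; eapply is_derive_cont, DPsi).
  assert (CdPsi : forall x, continuous (Derive Psi) x).
  { intros x; apply @ex_derive_continuous, (proj2 Psi_smooth 2%nat). }
  assert (DU : forall x, is_derive U x (Psi x)).
  { intros x; apply is_derive_potential, CPsi. }
  assert (PU : periodic U) by (apply potential_periodic; try apply Psi_smooth; assumption).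
  assert (EU : even U) by (apply potential_even; assumption).
  assert (Hk : 0 < kappa / (2 * PI)).
  { pose proof PI_RGT_0; apply Rdiv_lt_0_compat; lra. }
  assert (Hl2 : forall l : Z, l <> 0%Z -> 0 < IZR l ^ 2).
  { intros l Hl; apply pow2_gt_0, not_0_IZR, Hl. }
  split; [| split; [| split]].
  - apply potential_smooth; assumption.
  - intros a b g Hg t Ht; split.
    + apply (is_derive_free_energy kappa nu Phi Psi a b); assumption.
    + destruct Hg as [_ [Gd [Gpos _]]].
      apply Ropp_le_cancel; rewrite Ropp_0, Ropp_involutive.
      apply dissipation_nonneg; auto.
      * intros x; exact (proj1 (proj2 (proj2 (Gd t x Ht)))).
      * intros x; apply @ex_derive_continuous.
        destruct (Gd t x Ht) as [_ [_ [_ [_ H]]]]; exact (proj1 (proj2 (proj2 H))).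
  - intros Hsup h Hh l Hl.
    apply (mode_decays U Psi (Derive Psi) kappa nu l); auto.
    unfold rate; apply Rmult_lt_0_compat; [auto |].
    (* Each term lies below the least upper bound, so the strict bound passes to every single
       mode. *)
    assert (Hlt : kappa / (2 * PI) * Cmod (fourier U l) < nu).
    { refine (Rbar_le_lt_trans (Finite _) _ (Finite nu) _ Hsup).
      apply (proj1 (Lub_Rbar_correct _)); exists l; split; [exact Hl | reflexivity]. }
    pose proof (Rle_trans _ _ _ (Rmax_l _ _) (Rmax_Cmod (fourier U l))) as Hre.
    change (Rabs (Re (fourier U l)) <= Cmod (fourier U l)) in Hre.
    apply Rabs_le_between in Hre.
    assert (kappa / (2 * PI) * - Cmod (fourier U l) <= kappa / (2 * PI) * Re (fourier U l))
      by (apply Rmult_le_compat_l; lra).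
    lra.
  - intros [l [Hl Hre]]; exists l; split; [exact Hl |].
    apply (mode_grows U Psi (Derive Psi) kappa nu l); auto.
    unfold rate; pose proof (Hl2 l Hl) as H2.
    rewrite <- (Rmult_0_r (IZR l ^ 2)); apply Rmult_lt_compat_l; lra.
Qed.
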